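(* Let $(X,\mathtt{d})$ be an instance of metric $k$-center clustering with $z$ outliers, $|X|=n$, let $\epsilon>0$ and $\eta\in(0,1/2)$. If Algorithm 3 (described in the context) is run with $t=\frac{ck}{1-\eta}$ where $c=2+\frac{2}{k(1-\eta)}\ln\frac{1}{\eta}$, then with probability at least $1-2\eta$ its output $E$ satisfies $\phi_{\epsilon}(X,E)\leq 2r_{\mathtt{opt}}$.
   Context: Let $(X,\mathtt{d})$ be a finite metric space with $|X|=n$ and let $k,z$ be positive integers with $z<n$. The $k$-center clustering with $z$ outliers problem asks for $X'\subseteq X$ with $|X'|\geq n-z$ and centers $c_1,\dots,c_k\in X$ minimizing $\max_{p\in X'}\min_j\mathtt{d}(p,c_j)$; $r_{\mathtt{opt}}$ is the optimal value. For $\epsilon\geq0$ and $A\subseteq X$ of any size, $\phi_\epsilon(X,A)=\min\{\max_{p\in X'}\min_{c\in A}\mathtt{d}(p,c)\;:\;X'\subseteq X,\ |X'|\geq n-(1+\epsilon)z\}$; $\mathtt{d}(p,E)=\min_{q\in E}\mathtt{d}(p,q)$. Algorithm 3 (input $(X,\mathtt{d})$, $k,z$, parameters $\epsilon>0$, $\eta\in(0,1/2)$, $t\in\mathbb{Z}^+$): Let $\gamma=z/n$, $\sigma=\frac{2}{1+\sqrt{1+\frac{4(1+\epsilon)}{3\epsilon}}}$, $n'=\frac{3}{\sigma^2(1+\epsilon)\gamma}\log\frac{4}{\eta}$, and $E=\emptyset$. Set $j=1$ and add to $E$ $\frac{1}{1-\gamma}\log\frac1\eta$ vertices selected uniformly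 at random from $X$. While $j<t$: set $j=j+1$; sample $n'$ vertices uniformly at random from $X$, forming $A_j$; let $\hat r_j$ be the $(1+\sigma)(1+\epsilon)\gamma n'$-th largest value among $\{\mathtt{d}(p,E):p\in A_j\}$, and let $\hat A_j=\{p\in A_j:\mathtt{d}(p,E)\geq\hat r_j\}$; add $\hat A_j$ to $E$. Output $E$. *)

(* Defs.v *)
From HB Require Import structures.
From mathcomp Require Import all_boot all_order all_algebra.
From mathcomp Require Import all_classical all_reals.
From mathcomp Require Import exp.
Set Implicit Arguments. Unset Strict Implicit. Unset Printing Implicit Defensive.
Import Order.TTheory GRing.Theory Num.Theory.
Local Open Scope ring_scope.

Section KCenter.
Variables (R : realType) (T : finType) (d : T -> T -> R).

Definition is_metric : Prop :=
  [/\ forall p, d p p = 0,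
      forall p q, d p q = 0 -> p = q,
      forall p q, d p q = d q p &
      forall p q r, d p r <= d p q + d q r].

(* diameter: an upper bound for all distances, used as the neutral element
   of the finite minima below (it never changes a minimum over a nonempty
   range since every value it is compared with is <= diam). *)
Definition diam : R := \big[Num.max/0]_(p : T) \big[Num.max/0]_(q : T) d p q.

(* d(p, E) = min_{q in E} d(p, q)   (E nonempty in all uses) *)
Definition dist_set (p : T) (E : {set T}) : R :=
  \big[Num.min/diam]_(q in E) d p q.

Definition cover_cost (X' A : {set T}) : R :=
  \big[Num.max/0]_(p in X') dist_set p A.

Definition phi (z : nat) (eps : R) (A : {set T}) : R :=
  \big[Num.min/cover_cost [set: T]%SET A]_(X' : {set T} |
        (#|T|%:R - (1 + eps) * z%:R <= #|X'|%:R)) cover_cost X' A.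

Definition r_opt (k z : nat) : R :=
  \big[Num.min/diam]_(X' : {set T} | (#|T| - z <= #|X'|)%N)
    \big[Num.min/diam]_(c : {ffun 'I_k -> T})
        cover_cost X' [set c i | i : 'I_k].

Definition natceil (x : R) : nat := `|Num.ceil x|%N.

Definition gamma (z : nat) : R := z%:R / #|T|%:R.
Definition sigma (eps : R) : R :=
  2 / (1 + Num.sqrt (1 + 4 * (1 + eps) / (3 * eps))).
Definition nprime_real (z : nat) (eps eta : R) : R :=
  3 / ((sigma eps) ^+ 2 * (1 + eps) * gamma z) * ln (4 / eta).
Definition nprime (z : nat) (eps eta : R) : nat := natceil (nprime_real z eps eta).
Definition ninit (z : nat) (eta : R) : nat :=
  natceil (1 / (1 - gamma z) * ln (1 / eta)).
Definition rank (z : nat) (eps eta : R) : nat :=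
  natceil ((1 + sigma eps) * (1 + eps) * gamma z * (nprime z eps eta)%:R).
Definition c_const (k : nat) (eta : R) : R :=
  2 + 2 / (k%:R * (1 - eta)) * ln (1 / eta).
Definition t_param (k : nat) (eta : R) : R := c_const k eta * k%:R / (1 - eta).
(* number of iterations of "while j < t: j := j+1; ..." starting from j = 1 *)
Definition nrounds (t : R) : nat := (natceil t).-1.

(* One round of the loop, given the current E and the sampled A_j
   (a sequence of m vertices, sampled with replacement). *)
Definition round_step (z : nat) (eps eta : R) (m : nat)
    (E : {set T}) (A : {ffun 'I_m -> T}) : {set T} :=
  let vals := sort (fun x y : R => y <= x) [seq dist_set (A i) E | i <- enum 'I_m] in
  let rhat := nth 0 vals (rank z eps eta).-1 in
  E :|: [set A i | i in [pred i : 'I_m | rhat <= dist_set (A i) E]].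

(* Sample space of Algorithm 3: initial samples and, for each round,
   the n' samples A_j; all independent uniform draws from X. *)
Definition Omega (z : nat) (eps eta : R) (t : R) : finType :=
  ({ffun 'I_(ninit z eta) -> T} *
   {ffun 'I_(nrounds t) -> {ffun 'I_(nprime z eps eta) -> T}})%type.

Definition algo3 (z : nat) (eps eta t : R) (w : Omega z eps eta t) : {set T} :=
  foldl (round_step z eps eta (m := nprime z eps eta))
        [set w.1 i | i : 'I_(ninit z eta)]
        [seq w.2 j | j <- enum 'I_(nrounds t)].

Definition prob (O : finType) (P : pred O) : R :=
  #|[set w : O | P w]|%:R / #|O|%:R.

End KCenter.

(* Main.v *)
(** Fix an optimal solution: inliers I (all but at most z points) covered by k
balls of radius r = r_opt.  As long as phi_eps(X, E) > 2 r, more than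
(1 + eps) z points are farther than 2 r from E, hence more than eps z of them
are inliers, and any such inlier lies in an optimal cluster not yet hit by E.
Call a round good if fewer than [rank] samples are outliers and some sample is
a far inlier.  In a good round a far inlier is selected: if the sampled far
inlier is not, then at least [rank] samples are selected and all of them are
far, and they cannot all be outliers.  By Chernoff's bound for the first event
and (1 - eps gamma)^n' for the second, a round is good with probability at
least 1 - eta whatever the history.  Hence the potential
2^-(number of hit clusters), set to 0 once at most (1 + eps) z points are far,
shrinks on average by a factor (1 + eta) / 2 per round.  While far points
remain it is at least 2^(1-k), so Markov's inequality bounds the failure
probability by 2^(k-1) ((1 + eta) / 2)^(t-1) <= eta; the initial sample is not
even needed. *)

Require Import Defs.
From HB Require Import structures.
From mathcomp Require Import all_boot all_order all_algebra.
From mathcomp Require Import all_classical all_reals.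
From mathcomp Require Import exp.
From mathcomp Require Import sequences ring lra.
Import Order.TTheory GRing.Theory Num.Theory.
Local Open Scope ring_scope.
Set Implicit Arguments. Unset Strict Implicit. Unset Printing Implicit Defensive.

(** * Distances and selected samples *)

Section Distances.
Variables (R : realType) (T : finType) (d : T -> T -> R).

Lemma dist_le_diam p q : d p q <= diam d.
Proof.
by apply: le_trans (le_bigmax _ _ p); exact: (le_bigmax _ (d p) q).
Qed.

Lemma diam_ge0 : 0 <= diam d.
Proof. exact: bigmax_ge_id. Qed.

Lemma dist_set_le_diam p (E : {set T}) : dist_set d p E <= diam d.
Proof. exact: bigmin_le_id. Qed.

Lemma dist_set_le p q (E : {set T}) : q \in E -> dist_set d p E <= d p q.
Proof. exact: bigmin_le_cond. Qed.

Lemma dist_set_anti p (E E' : {set T}) :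
  E \subset E' -> dist_set d p E' <= dist_set d p E.
Proof. by move=> /fintype.subsetP sEE'; exact: sub_bigmin. Qed.

(** The default [diam] bounds every distance, so it cannot undercut the minimum over a nonempty
    set. *)
Lemma dist_set_attained p q (E : {set T}) :
  q \in E -> exists2 c, c \in E & dist_set d p E = d p c.
Proof.
move=> qE; have [||c cE dE] := @eq_bigmin _ _ _ (diam d) q (fun c => c \in E) (d p).
- by [].
- by move=> i _; exact: dist_le_diam.
- by exists c.
Qed.

Lemma dist_ge0 : is_metric d -> forall p q, 0 <= d p q.
Proof.
by case=> d0 _ dC dtri p q; have := dtri p q p; rewrite d0 (dC q p); lra.
Qed.

Lemma dist_set_ge0 p (E : {set T}) : is_metric d -> 0 <= dist_set d p E.
Proof.
by move=> dM; apply: le_bigmin => [|q _]; [exact: diam_ge0 | exact: dist_ge0].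
Qed.

Lemma cover_cost_le_diam (X E : {set T}) : cover_cost d X E <= diam d.
Proof.
by apply/bigmax_leP; split=> [|p _]; [exact: diam_ge0 | exact: dist_set_le_diam].
Qed.

Lemma r_opt_ge0 k z : 0 <= r_opt d k z.
Proof.
apply: le_bigmin => [|X _]; first exact: diam_ge0.
apply: le_bigmin => [|c _]; first exact: diam_ge0.
exact: bigmax_ge_id.
Qed.

(** This fixes an optimal solution: [diam] bounds every cover cost, so both nested minima are
    attained despite their default. *)
Lemma r_opt_attained k z : (0 < k)%N -> (0 < #|T|)%N ->
  exists (I : {set T}) (c : {ffun 'I_k -> T}), (#|T| - z <= #|I|)%N /\
    forall p, p \in I -> exists i, d p (c i) <= r_opt d k z.
Proof.
move=> k0 /card_gt0P[x0 _].
have [||I PI rE] := @eq_bigmin _ _ _ (diam d) [set: T]%SET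
    (fun X : {set T} => #|T| - z <= #|X|)%N
    (fun X => \big[Num.min/diam d]_(c : {ffun 'I_k -> T})
        cover_cost d X [set c i | i : 'I_k]).
- by rewrite cardsT leq_subr.
- by move=> X _; exact: bigmin_le_id.
have [||c _ cE] := @eq_bigmin _ _ _ (diam d) [ffun=> x0] xpredT
    (fun c : {ffun 'I_k -> T} => cover_cost d I [set c i | i : 'I_k]).
- by [].
- by move=> c _; exact: cover_cost_le_diam.
exists I, c; split=> // p pI.
have [|q /imsetP[i _ ->] pq] := @dist_set_attained p (c (Ordinal k0))
    [set c i | i : 'I_k].
  exact: imset_f.
exists i; rewrite /r_opt rE cE -pq.
exact: (le_bigmax_cond _ (fun p => dist_set d p [set c i | i : 'I_k])).
Qed.

Definition far (r : R) (E : {set T}) : {set T} := [set p | r < dist_set d p E].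

Lemma far_anti r (E E' : {set T}) : E \subset E' -> far r E' \subset far r E.
Proof.
move=> sEE'; apply/fintype.subsetP => p; rewrite !inE => /lt_le_trans; apply.
exact: dist_set_anti.
Qed.

(** The complement of the far set is an admissible [X'] in [phi], and it lies within [r] of [E]. *)
Lemma phi_le z eps r (E : {set T}) :
  0 <= r -> #|far r E|%:R <= (1 + eps) * z%:R -> phi d z eps E <= r.
Proof.
move=> r0 farE; apply: (@bigmin_inf _ _ _ _ (~: far r E)).
  have -> : #|T| = (#|far r E| + #|~: far r E|)%N by rewrite cardsC.
  by rewrite natrD; lra.
by apply/bigmax_leP; split=> // p; rewrite !inE -leNgt.
Qed.

End Distances.

(** The first [k] entries in decreasing order are at least the [k]-th one; ties only raise the
    count. *)
Lemma count_ge_nth_sort (R : realDomainType) (s : seq R) k :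
  (0 < k <= size s)%N ->
  (k <= count (fun x => (nth 0 (sort (fun x y : R => y <= x) s) k.-1 <= x)%R)
          s)%N.
Proof.
case: k => // k /= ks; set t := sort _ s.
have tE : perm_eq t s by rewrite perm_sort.
rewrite -(permP tE) -[X in count _ X](cat_take_drop k.+1) count_cat.
apply: leq_trans (leq_addr _ _).
have st : size (take k.+1 t) = k.+1.
  by rewrite size_takel// (perm_size tE).
rewrite -[X in (X <= _)%N]st eq_leq//; apply/esym/eqP; rewrite -all_count.
apply/(all_nthP 0) => i; rewrite st ltnS => ik.
rewrite nth_take//.
apply: (@sorted_leq_nth _ (fun x y : R => y <= x)) => //.
- by move=> x y w /[swap]; exact: le_trans.
- by apply: sort_sorted => x y; exact: le_total.
- by rewrite inE (perm_size tE) (leq_ltn_trans ik).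
- by rewrite inE (perm_size tE).
Qed.

Section Round.
Variables (R : realType) (T : finType) (d : T -> T -> R).
Variables (z : nat) (eps eta : R) (m : nat).

Lemma subset_round_step (E : {set T}) (A : {ffun 'I_m -> T}) :
  E \subset round_step d z eps eta E A.
Proof. exact: finset.subsetUl. Qed.

(* If a sampled inlier of F is not selected, then at least [rank] samples are
   farther than it, hence lie in F, and they cannot all be outliers. *)
Lemma round_step_selects (I E : {set T}) (A : {ffun 'I_m -> T}) r :
  is_metric d -> 0 <= r -> (0 < rank T z eps eta)%N ->
  (#|[set i | A i \in ~: I]| < rank T z eps eta)%N ->
  (exists i, A i \in I :&: far d r E) ->
  exists2 f, f \in I :&: far d r E & f \in round_step d z eps eta E A.
Proof.
move=> dM r0 rank0 outA [i Ai].
rewrite /round_step; set vals := [seq _ | i <- _].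
set rhat := nth 0 _ _.
have [le_r|lt_r] := leP rhat (dist_set d (A i) E).
  by exists (A i) => //; rewrite inE; apply/orP; right; apply: imset_f.
have szv : size vals = m by rewrite size_map size_enum_ord.
(* If [rank] exceeded [m], [nth] would return its default 0, and the nonnegative distance of [A i]
   could not lie below it. *)
have rank_m : (rank T z eps eta <= m)%N.
  rewrite leqNgt; apply/negP => mr; move: lt_r.
  rewrite /rhat nth_default ?ltNge ?dist_set_ge0//.
  by rewrite size_sort szv -ltnS prednK.
have selc : (rank T z eps eta <= #|[set j | (rhat <= dist_set d (A j) E)%R]|)%N.
  have := @count_ge_nth_sort _ vals (rank T z eps eta).
  rewrite rank0 szv rank_m => /(_ isT) /leq_trans; apply.
  by rewrite count_map enumT cardsE cardE /enum_mem size_filter.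
have [j] : exists j, j \in [set j | rhat <= dist_set d (A j) E] :\:
                         [set j | A j \in ~: I].
  apply/finset.set0Pn; rewrite finset.setD_eq0; apply/negP => /subset_leq_card.
  by rewrite leqNgt (leq_trans outA).
rewrite !inE negbK => /andP[AjI hj]; exists (A j).
  rewrite !inE AjI /=; move: Ai; rewrite !inE => /andP[_ /lt_trans]; apply.
  exact: lt_le_trans hj.
by rewrite !inE; apply/orP; right; apply: imset_f.
Qed.

End Round.

Section Clusters.
Variables (R : realType) (T : finType) (d : T -> T -> R) (k : nat).
Variables (c : 'I_k -> T) (r : R).

Definition hit_clusters (E : {set T}) : {set 'I_k} :=
  [set i | [exists p in E, d p (c i) <= r]].

Lemma hit_clusters_mono (E E' : {set T}) :
  E \subset E' -> hit_clusters E \subset hit_clusters E'.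
Proof.
move=> /fintype.subsetP sEE'; apply/fintype.subsetP => i; rewrite !inE.
by move=> /existsP[p /andP[/sEE' pE' dp]]; apply/existsP; exists p; rewrite pE'.
Qed.

(** A point of [E] in the same ball as [p] would be within [2 * r] of [p], going through the
    center. *)
Lemma far_not_hit (E : {set T}) p i : is_metric d ->
  p \in far d (2 * r) E -> d p (c i) <= r -> i \notin hit_clusters E.
Proof.
move=> [_ _ dC dtri]; rewrite !inE => fp pci; apply/negP => /existsP[q /andP[qE qci]].
have := dist_set_le d p qE; have := dtri p (c i) q.
by rewrite (dC (c i)); lra.
Qed.

End Clusters.

(** * Independent samples and iterated rounds *)

Section Sampling.
Variables (R : realType) (T : finType) (m : nat).
Implicit Types S : {set T}.

(** The indicator is a product over the samples, so the sum over all sample vectors factors. *)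
Lemma sum_avoid S :
  \sum_(A : {ffun 'I_m -> T}) ([forall i, A i \notin S])%:R
  = (#|T|%:R - #|S|%:R) ^+ m :> R.
Proof.
rewrite (eq_bigr (fun A : {ffun 'I_m -> T} => \prod_i (A i \notin S)%:R)).
  2:{ move=> A _; have [/forallP AS|] := boolP [forall i, A i \notin S].
    by rewrite big1// => i _; rewrite AS.
  rewrite negb_forall => /existsP[i Ai].
  by rewrite (bigD1 i)//= (negbTE Ai) mul0r. }
rewrite -(bigA_distr_bigA (fun (_ : 'I_m) x => (x \notin S)%:R : R)).
rewrite prodr_const card_ord; congr (_ ^+ _).
rewrite -natr_sum; have -> : #|T| = (#|S| + #|~: S|)%N by rewrite cardsC.
rewrite natrD addrC addKr; congr (_%:R).
by rewrite -sum1_card [RHS]big_mkcond/=; apply: eq_bigr => x _; rewrite inE; case: ifP.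
Qed.

(** Exponential Markov inequality: the indicator is at most [expR (lam * (N - a))], N being the
    number of samples in [S], and this factors over the samples. The real [a] absorbs the rounding
    in [rank]. *)
Lemma chernoff S (lam a : R) (h : nat) : 0 <= lam -> a <= h%:R ->
  \sum_(A : {ffun 'I_m -> T}) (h <= #|[set i | A i \in S]|)%N%:R
  <= expR (- lam * a) * (#|T|%:R + #|S|%:R * (expR lam - 1)) ^+ m.
Proof.
move=> lam0 ah.
have prodE (A : {ffun 'I_m -> T}) :
    \prod_i expR (lam * (A i \in S)%:R) = expR (lam * #|[set i | A i \in S]|%:R).
  rewrite -expR_sum -mulr_sumr -natr_sum -sum1_card [in RHS]big_mkcond/=.
  by congr (expR (_ * _%:R)); apply: eq_bigr => i _; rewrite inE; case: ifP.
have -> : #|T|%:R + #|S|%:R * (expR lam - 1)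
    = \sum_(x : T) expR (lam * (x \in S)%:R).
  rewrite (eq_bigr (fun x => 1 + (x \in S)%:R * (expR lam - 1))); last first.
    by move=> x _; case: (x \in S); rewrite ?(mulr1, mulr0, mul1r, mul0r)
      ?expR0 ?addr0// addrC subrK.
  rewrite big_split/= sumr_const -mulr_suml -natr_sum -(sum1_card (mem S)).
  rewrite [in LHS]big_mkcond/=.
  by congr (_ + _%:R * _); apply: eq_bigr => x _; case: ifP.
have prod_const (x : R) : x ^+ m = \prod_(i < m) x.
  by rewrite prodr_const card_ord.
rewrite prod_const.
rewrite (bigA_distr_bigA (fun (_ : 'I_m) x => expR (lam * (x \in S)%:R))).
rewrite mulr_sumr; apply: ler_sum => A _; rewrite prodE -expRD.
case: leqP => hA; last exact: expR_ge0.
rewrite /= -[leLHS]expR0 ler_expR mulNr addrC subr_ge0 ler_wpM2l//.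
by apply: le_trans ah _; rewrite ler_nat.
Qed.

End Sampling.

Section IteratedPotential.
Variables (R : realType) (B : finType) (St : Type) (step : St -> B -> St).
Variables (Psi : St -> R) (rho : R).

Lemma big_ffun_ordS N (F : seq B -> R) :
  \sum_(w : {ffun 'I_N.+1 -> B}) F [seq w j | j <- enum 'I_N.+1]
  = \sum_(b : B) \sum_(w : {ffun 'I_N -> B}) F (b :: [seq w j | j <- enum 'I_N]).
Proof.
rewrite pair_big/=.
rewrite (reindex (fun bw : B * {ffun 'I_N -> B} =>
   [ffun i : 'I_N.+1 => oapp bw.2 bw.1 (unlift ord0 i)]))/=.
  apply: eq_bigr => -[b w] _ /=; congr F.
  rewrite enum_ordSl/= ffunE unlift_none/= -map_comp.
  by congr (_ :: _); apply: eq_map => j /=; rewrite ffunE liftK.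
exists (fun w => (w ord0, [ffun j => w (lift ord0 j)])) => [[b w]|w] _ /=.
  rewrite ffunE unlift_none/=; congr (_, _).
  by apply/ffunP => j; rewrite !ffunE liftK.
apply/ffunP => i; rewrite ffunE; case: unliftP => [j ->|->]//=.
by rewrite ffunE.
Qed.

(** Induction splits off the first round: the later rounds are averaged from whatever state it
    produces, then the first round is averaged. *)
Lemma sum_foldl_le N s : 0 <= rho ->
  (forall s', \sum_b Psi (step s' b) <= rho * #|B|%:R * Psi s') ->
  \sum_(w : {ffun 'I_N -> B}) Psi (foldl step s [seq w j | j <- enum 'I_N])
  <= (rho * #|B|%:R) ^+ N * Psi s.
Proof.
move=> rho0 hstep; elim: N s => [|N IH] s.
  rewrite expr0 mul1r (eq_bigr (fun=> Psi s)); last first.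
    by move=> w _; rewrite (size0nil (s := enum 'I_0)) ?size_enum_ord.
  by rewrite sumr_const card_ffun card_ord expn0.
rewrite (big_ffun_ordS N (fun l => Psi (foldl step s l)))/=.
have rhoN0 : 0 <= (rho * #|B|%:R) ^+ N by rewrite exprn_ge0// mulr_ge0.
rewrite exprSr -mulrA; apply: le_trans (ler_wpM2l rhoN0 (hstep s)).
by rewrite mulr_sumr; apply: ler_sum => b _; exact: IH.
Qed.

Lemma sum_foldl_init_le (W : finType) (init : W -> St) N : 0 <= rho ->
  (forall s, Psi s <= 1) ->
  (forall s, \sum_b Psi (step s b) <= rho * #|B|%:R * Psi s) ->
  \sum_(w : W * {ffun 'I_N -> B})
     Psi (foldl step (init w.1) [seq w.2 j | j <- enum 'I_N])
  <= #|{: W * {ffun 'I_N -> B}}|%:R * rho ^+ N.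
Proof.
move=> rho0 Psi1 hstep.
rewrite -(pair_bigA _ (fun (v : W) (w : {ffun 'I_N -> B}) =>
  Psi (foldl step (init v) [seq w j | j <- enum 'I_N])))/=.
apply: le_trans (ler_sum _ (fun v _ => sum_foldl_le N (init v) rho0 hstep)) _.
rewrite -mulr_sumr card_prod natrM card_ffun card_ord natrX exprMn.
rewrite -[leRHS]mulrA mulrC [X in _ <= _ * X]mulrC ler_wpM2r//.
  by rewrite mulr_ge0 ?exprn_ge0.
apply: le_trans (ler_sum _ (fun v _ => Psi1 (init v))) _.
by rewrite sumr_const.
Qed.

End IteratedPotential.

(** * Numerical estimates *)

Section Estimates.
Variable R : realType.
Implicit Types x eps eta : R.

Lemma le_natceil x : x <= (natceil x)%:R.
Proof.
apply: le_trans (Num.Theory.ceil_ge x) _.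
by rewrite natr_absz ler_int ler_norm.
Qed.

(** Square the bound at y = x / 2: beyond 1 + 2 y, the square is (1 + 2 c + 2 c y + c^2 y^2) y^2,
    where y <= a and y^2 = x^2 / 4. *)
Lemma expR_double (a c c' : R) : 0 <= a -> 0 <= c ->
  (1 + 2 * c) / 4 + c * a / 2 + c ^+ 2 * a ^+ 2 / 4 <= c' ->
  (forall x, 0 <= x <= a -> expR x <= 1 + x + c * x ^+ 2) ->
  forall x, 0 <= x <= 2 * a -> expR x <= 1 + x + c' * x ^+ 2.
Proof.
move=> a0 c0 cc' H x /andP[x0 xa].
have xE : x = x / 2 + x / 2 by field.
have {1}-> := xE; rewrite expRD.
set y := x / 2 in xE *.
have y0 : 0 <= y by rewrite /y; lra.
have ya : y <= a by rewrite /y; lra.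
have /H Hy : 0 <= y <= a by rewrite y0.
have e0 := expR_ge0 y.
apply: le_trans (_ : (1 + y + c * y ^+ 2) * (1 + y + c * y ^+ 2) <= _).
  by apply: ler_pM.
have y2a : y ^+ 2 <= a ^+ 2 by rewrite ler_sqr ?nnegrE.
have cya : c * y <= c * a by apply: ler_wpM2l.
have c2 : c ^+ 2 * y ^+ 2 <= c ^+ 2 * a ^+ 2 by apply: ler_wpM2l; rewrite ?sqr_ge0.
have : (1 + 2 * c + 2 * (c * y) + c ^+ 2 * y ^+ 2) * y ^+ 2 <= 4 * c' * y ^+ 2.
  by apply: ler_wpM2r; rewrite ?sqr_ge0//; lra.
by rewrite xE; lra.
Qed.

(* From exp y <= 1 / (1 - y) on [0, 1/24], squaring four times. *)
Lemma expR_le_quadratic x : 0 <= x <= 2 / 3 -> expR x <= 1 + x + 3 / 4 * x ^+ 2.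
Proof.
have H0 (y : R) : 0 <= y <= 1 / 24 -> expR y <= 1 + y + 11 / 10 * y ^+ 2.
  move=> /andP[y0 y1].
  have := expR_ge1Dx (- y); rewrite expRN => Hy.
  have e0 := expR_gt0 y.
  have : (1 - y) * expR y <= 1.
    by rewrite -ler_pdivlMr// div1r.
  have : 1 <= (1 - y) * (1 + y + 11 / 10 * y ^+ 2).
    have := sqr_ge0 y; have : 0 <= y ^+ 2 * (1 / 24 - y).
      by rewrite mulr_ge0 ?sqr_ge0//; lra.
    by lra.
  move=> Hle /le_trans/(_ Hle); rewrite ler_pM2l//; lra.
(* The constants 83/100, 71/100, 67/100 and 3/4 each round up what [expR_double] yields from the
   previous one. *)
have H1 : forall y : R, 0 <= y <= 2 * (1 / 24) -> expR y <= 1 + y + 83 / 100 * y ^+ 2.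
  by apply: (expR_double _ _ _ H0); lra.
have H2 : forall y : R, 0 <= y <= 2 * (2 * (1 / 24)) ->
    expR y <= 1 + y + 71 / 100 * y ^+ 2.
  by apply: (expR_double _ _ _ H1); lra.
have H3 : forall y : R, 0 <= y <= 2 * (2 * (2 * (1 / 24))) ->
    expR y <= 1 + y + 67 / 100 * y ^+ 2.
  by apply: (expR_double _ _ _ H2); lra.
have H4 : forall y : R, 0 <= y <= 2 * (2 * (2 * (2 * (1 / 24)))) ->
    expR y <= 1 + y + 3 / 4 * y ^+ 2.
  by apply: (expR_double _ _ _ H3); lra.
by move=> hx; apply: H4; lra.
Qed.

(** [sigma eps] is the positive root of (1 + eps) s^2 = 3 eps (1 - s). This identity lets the sample
    size chosen for the outlier tail also serve for hitting a far inlier. *)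
Lemma sigmaP eps : 0 < eps ->
  [/\ 0 < sigma eps, sigma eps < 1 &
      sigma eps ^+ 2 * (1 + eps) = 3 * eps * (1 - sigma eps)].
Proof.
move=> e0; rewrite /sigma; set q := Num.sqrt _.
have r0 : 0 < 4 * (1 + eps) / (3 * eps) by apply: divr_gt0; lra.
have q2 : q ^+ 2 = 1 + 4 * (1 + eps) / (3 * eps) by rewrite sqr_sqrtr//; lra.
have q0 : 0 <= q by exact: sqrtr_ge0.
have q1 : 1 < q by rewrite -(ltr_sqr (x := 1)) ?nnegrE// expr1n q2; lra.
split.
- by apply: divr_gt0; lra.
- by rewrite ltr_pdivrMr; lra.
- have -> : 1 + eps = 3 * eps / 4 * (q ^+ 2 - 1).
    by rewrite q2; field; apply/lt0r_neq0; lra.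
  by field; apply/lt0r_neq0; lra.
Qed.

(** With p = 1 - eta and L = ln (1 / eta), use 2 <= e and (1 + eta) / 2 <= exp (- p / 2). The
    exponent is at most k - 1 - p (t - 1) / 2 = p / 2 - 1 - L / p <= - L. *)
Lemma rounds_bound k eta : (0 < k)%N -> 0 < eta -> eta < 1 ->
  2 ^+ k.-1 * ((1 + eta) / 2) ^+ nrounds (t_param k eta) <= eta.
Proof.
move=> k0 eta0 eta1; set p := 1 - eta.
have p0 : 0 < p by rewrite /p; lra.
have kR : (0 : R) < k%:R by rewrite ltr0n.
set L := ln (1 / eta).
have L0 : 0 <= L by apply: ln_ge0; rewrite ler_pdivlMr; lra.
have LE : eta = expR (- L).
  by rewrite expRN lnK ?posrE ?divr_gt0// div1r invrK.
have NE : t_param k eta - 1 <= (nrounds (t_param k eta))%:R.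
  apply: le_trans (_ : (natceil (t_param k eta))%:R - 1 <= _).
    by rewrite lerD2r le_natceil.
  by rewrite lerBlDr natr1 ler_nat leqSpred.
move: (nrounds _) NE => N NE.
have tE : t_param k eta * p = 2 * k%:R + 2 * (L / p).
  rewrite /t_param /c_const -/p -/L; field.
  by rewrite !lt0r_neq0.
have Lp : L <= L / p by rewrite ler_pdivlMr// /p; nra.
have h2 : 2 ^+ k.-1 <= expR (k%:R - 1 : R).
  have -> : k%:R - 1 = 1 * k.-1%:R :> R by rewrite mul1r -{1}(prednK k0) -natr1; ring.
  rewrite expRM_natr lerXn2r// ?nnegrE ?expR_ge0//.
  by have := @expR_ge1Dx R 1; lra.
have hN : ((1 + eta) / 2) ^+ N <= expR (- (p / 2) * N%:R).
  rewrite expRM_natr lerXn2r// ?nnegrE ?expR_ge0//; first by lra.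
  by have := @expR_ge1Dx R (- (p / 2)); rewrite /p; lra.
apply: le_trans (_ : expR (k%:R - 1) * expR (- (p / 2) * N%:R) <= _).
  apply: (ler_pM _ _ h2 hN); first exact: exprn_ge0.
  by apply: exprn_ge0; lra.
rewrite -expRD [leRHS]LE ler_expR.
have pN : p * (t_param k eta - 1) <= p * N%:R by rewrite ler_pM2l.
by have : p <= 1; [rewrite /p|]; lra.
Qed.

End Estimates.

(** * Failure probabilities of one round *)

Section OneRound.
Variables (R : realType) (T : finType).

Lemma gamma_gt0 z : (0 < z)%N -> (z < #|T|)%N -> 0 < gamma R T z.
Proof.
by move=> z0 zT; apply: divr_gt0; rewrite ltr0n// (leq_ltn_trans _ zT).
Qed.

Lemma card_gamma z : (z < #|T|)%N -> #|T|%:R * gamma R T z = z%:R.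
Proof.
by move=> zT; rewrite /gamma mulrC divfK// pnatr_eq0 -lt0n (leq_ltn_trans _ zT).
Qed.

Lemma nprime_ge z (eps eta : R) : (0 < z)%N -> (z < #|T|)%N -> 0 < eps ->
  3 * ln (4 / eta)
  <= sigma eps ^+ 2 * (1 + eps) * gamma R T z * (nprime T z eps eta)%:R.
Proof.
move=> z0 zT eps0; have [s0 s1 _] := sigmaP eps0.
have g0 := gamma_gt0 z0 zT.
have e1 : 0 < 1 + eps by lra.
have D0 : 0 < sigma eps ^+ 2 * (1 + eps) * gamma R T z.
  by apply: mulr_gt0 => //; apply: mulr_gt0 => //; exact: exprn_gt0.
rewrite mulrC -ler_pdivrMl// mulrC.
apply: le_trans (le_natceil _); rewrite /nprime_real.
by rewrite le_eqVlt; apply/orP; left; apply/eqP; field; rewrite !lt0r_neq0.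
Qed.

(** As 4 / eta > 1, its logarithm is positive and forces a nonempty sample. Positivity makes the
    predecessor of [rank] in [round_step] a genuine index shift. *)
Lemma rank_gt0 z (eps eta : R) : (0 < z)%N -> (z < #|T|)%N -> 0 < eps ->
  0 < eta -> eta < 1 -> (0 < rank T z eps eta)%N.
Proof.
move=> z0 zT eps0 eta0 eta1; have [s0 s1 _] := sigmaP eps0.
have g0 := gamma_gt0 z0 zT.
have L0 : 0 < ln (4 / eta) by apply: ln_gt0; rewrite ltr_pdivlMr; lra.
have m0 : 0 < (nprime T z eps eta)%:R :> R.
  rewrite ltr0n lt0n; apply/eqP => mE; have := nprime_ge eta z0 zT eps0.
  by rewrite mE mulr0; lra.
rewrite -(ltr0n R); apply: lt_le_trans (le_natceil _).
have [e1 s2] : 0 < 1 + eps /\ 0 < 1 + sigma eps by split; lra.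
by apply: mulr_gt0 => //; apply: mulr_gt0 => //; exact: mulr_gt0.
Qed.

Lemma expRN_ln4 (eta : R) : 0 < eta -> expR (- ln (4 / eta)) = eta / 4.
Proof. by move=> eta0; rewrite expRN lnK ?posrE ?divr_gt0// invf_div. Qed.

Lemma many_outliers_bound z (eps eta : R) (Z : {set T}) :
  (0 < z)%N -> (z < #|T|)%N -> 0 < eps -> 0 < eta -> (#|Z| <= z)%N ->
  \sum_(A : {ffun 'I_(nprime T z eps eta) -> T})
     (rank T z eps eta <= #|[set i | A i \in Z]|)%N%:R
  <= #|T|%:R ^+ nprime T z eps eta * (eta / 4).
Proof.
move=> z0 zT eps0 eta0 Zz; have [s0 s1 _] := sigmaP eps0.
have g0 := gamma_gt0 z0 zT; have gn := card_gamma zT.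
have mL := nprime_ge eta z0 zT eps0.
set m := nprime T z eps eta in mL *.
set g := gamma R T z in g0 gn mL.
have n0 : 0 < #|T|%:R :> R by rewrite ltr0n (leq_ltn_trans _ zT).
have zR0 : 0 < z%:R :> R by rewrite ltr0n.
set s := sigma eps in s0 s1 mL.
(* 2 s / 3 minimizes the Chernoff exponent x + 3/4 x^2 - (1 + s) x. *)
set lam := 2 / 3 * s.
have lam0 : 0 <= lam by rewrite /lam; lra.
have lamE : expR lam <= 1 + lam + 3 / 4 * lam ^+ 2.
  by apply: expR_le_quadratic; rewrite /lam; lra.
have lamE1 : 0 <= expR lam - 1 by have := expR_ge1Dx lam; lra.
have rankE : (1 + s) * (1 + eps) * g * m%:R <= (rank T z eps eta)%:R.
  exact: le_natceil.
apply: le_trans (@chernoff R T m Z lam _ _ lam0 rankE) _.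
(* Enlarging the density of [Z] to (1 + eps) g gives the mean and the threshold a common factor;
   then 1 + x <= exp x applies. *)
have base : #|T|%:R + #|Z|%:R * (expR lam - 1)
    <= #|T|%:R * expR ((1 + eps) * g * (lam + 3 / 4 * lam ^+ 2)).
  apply: le_trans (_ : #|T|%:R * (1 + (1 + eps) * g * (expR lam - 1)) <= _).
    rewrite [leRHS]mulrDr mulr1 lerD2l mulrA ler_wpM2r// mulrCA gn.
    by apply: le_trans (_ : z%:R <= _); [rewrite ler_nat | nra].
  rewrite ler_pM2l//; apply: le_trans (expR_ge1Dx _).
  by rewrite lerD2l ler_pM2l; [lra | rewrite mulr_gt0//; lra].
have base0 : 0 <= #|T|%:R + #|Z|%:R * (expR lam - 1).
  by rewrite addr_ge0 ?mulr_ge0// ltW.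
apply: le_trans (ler_wpM2l (expR_ge0 _) (lerXn2r m _ _ base)) _.
- by rewrite nnegrE.
- by rewrite nnegrE mulr_ge0 ?expR_ge0 ?ltW.
rewrite exprMn -expRM_natr mulrCA ler_wpM2l ?exprn_ge0 ?(ltW n0)// -expRD.
(* With this [lam] the total exponent is - (s^2 / 3) (1 + eps) g m, which [mL] bounds by - ln (4 /
   eta). *)
rewrite -(expRN_ln4 eta0) ler_expR -/m -/g -/s /lam.
by lra.
Qed.

Lemma no_hit_bound z (eps eta : R) (F : {set T}) :
  (0 < z)%N -> (z < #|T|)%N -> 0 < eps -> 0 < eta ->
  eps * z%:R <= #|F|%:R ->
  \sum_(A : {ffun 'I_(nprime T z eps eta) -> T}) ([forall i, A i \notin F])%:R
  <= #|T|%:R ^+ nprime T z eps eta * (eta / 4).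
Proof.
move=> z0 zT eps0 eta0 eF; have [s0 s1 sE] := sigmaP eps0; rewrite sum_avoid.
have g0 := gamma_gt0 z0 zT; have gn := card_gamma zT.
have mL := nprime_ge eta z0 zT eps0.
have n0 : 0 < #|T|%:R :> R by rewrite ltr0n (leq_ltn_trans _ zT).
(* Now [mL] reads ln (4 / eta) <= eps (1 - sigma) gamma m up to the factor 3; the factor 1 - sigma
   <= 1 is dropped at the end. *)
rewrite sE in mL; set m := nprime T z eps eta in mL *.
have base : #|T|%:R - #|F|%:R <= #|T|%:R * expR (- (eps * gamma R T z)).
  apply: le_trans (_ : #|T|%:R * (1 + - (eps * gamma R T z)) <= _).
    by rewrite mulrDr mulr1 lerD2l mulrN lerN2 mulrCA gn.
  by rewrite ler_pM2l// expR_ge1Dx.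
apply: le_trans (lerXn2r m _ _ base) _.
- by rewrite nnegrE subr_ge0 ler_nat max_card.
- by rewrite nnegrE mulr_ge0 ?expR_ge0 ?ltW.
rewrite exprMn ler_pM2l ?exprn_gt0// -expRM_natr -(expRN_ln4 eta0) ler_expR mulNr.
rewrite lerN2.
have h0 : 0 <= eps * gamma R T z * m%:R by rewrite mulr_ge0// ltW// mulr_gt0.
have : (1 - sigma eps) * (eps * gamma R T z * m%:R)
    <= 1 * (eps * gamma R T z * m%:R).
  by apply: ler_wpM2r; lra.
by lra.
Qed.

End OneRound.

(** * The potential *)

Section Progress.
Variables (R : realType) (T : finType) (d : T -> T -> R) (k z : nat).
Variables (eps eta r : R) (I : {set T}) (c : 'I_k -> T).
Hypothesis dM : is_metric d.
Hypothesis outliers_le : (#|~: I| <= z)%N.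
Hypothesis I_covered : forall p, p \in I -> exists i, d p (c i) <= r.

Local Notation unfinished E := ((1 + eps) * z%:R < #|far d (2 * r) E|%:R).

Lemma far_inliers_ge E : unfinished E -> eps * z%:R < #|I :&: far d (2 * r) E|%:R.
Proof.
move=> farE; suff : #|far d (2 * r) E|%:R <= #|I :&: far d (2 * r) E|%:R + z%:R :> R.
  by move: farE; lra.
rewrite -natrD ler_nat -(cardsID I (far d (2 * r) E)) finset.setIC leq_add2l.
apply: leq_trans outliers_le; apply: subset_leq_card.
by apply/fintype.subsetP => p; rewrite !inE => /andP[].
Qed.

Lemma unfinished_hit_lt E : 0 <= eps -> unfinished E ->
  (#|hit_clusters d c r E| < k)%N.
Proof.
move=> eps0 /far_inliers_ge Ifar.
have [p] : exists p, p \in I :&: far d (2 * r) E.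
  apply/card_gt0P; rewrite -(ltr0n R); apply: le_lt_trans Ifar.
  by rewrite mulr_ge0.
rewrite finset.inE => /andP[/I_covered[i pi] pf].
have := far_not_hit dM pf pi; rewrite -[in X in (_ < X)%N](card_ord k) => ih.
apply: proper_card; apply/properP; split; first exact/fintype.subsetP.
by exists i.
Qed.

(** The optimal cluster of the selected far inlier was not hit before the round and is hit after
    it. *)
Lemma round_hits_new m (E : {set T}) (A : {ffun 'I_m -> T}) :
  0 <= r -> (0 < rank T z eps eta)%N ->
  (#|[set i | A i \in ~: I]| < rank T z eps eta)%N ->
  (exists i, A i \in I :&: far d (2 * r) E) ->
  (#|hit_clusters d c r E|
   < #|hit_clusters d c r (round_step d z eps eta E A)|)%N.
Proof.
move=> r0 rank0 outA hitA.
have r20 : 0 <= 2 * r by rewrite mulr_ge0.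
have [f] := round_step_selects dM r20 rank0 outA hitA.
rewrite finset.inE => /andP[/I_covered[i fi] ff] fE.
apply: proper_card; apply/properP; split.
  exact: hit_clusters_mono (subset_round_step _ _ _ _ _ _).
exists i; last exact: far_not_hit ff fi.
by rewrite !inE; apply/existsP; exists f; rewrite fE.
Qed.

Definition potential (E : {set T}) : R :=
  (unfinished E)%:R * 2^-1 ^+ #|hit_clusters d c r E|.

Lemma potential_le1 E : potential E <= 1.
Proof.
rewrite /potential; case: (unfinished E); last by rewrite mul0r.
by rewrite mul1r exprn_ile1//; lra.
Qed.

(** This is the pointwise bound behind Markov's inequality: an unfinished [E] hits at most k - 1
    clusters. *)
Lemma unfinished_le_potential E : 0 <= eps ->
  (unfinished E)%:R <= 2 ^+ k.-1 * potential E.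
Proof.
move=> eps0; rewrite /potential.
have [unE|_] := boolP (unfinished E); last by rewrite mul0r mulr0.
have hk : (#|hit_clusters d c r E| <= k.-1)%N.
  have hk := unfinished_hit_lt eps0 unE.
  by rewrite -ltnS (ltn_predK hk).
rewrite mul1r exprVn -ler_pdivrMr ?invr_gt0 ?exprn_gt0// invrK mul1r.
by rewrite ler_weXn2l// ler1n.
Qed.

(** A good round halves the potential. Otherwise some indicator is 1, so the factor is at least 1,
    and monotonicity of far sets and hit clusters suffices. *)
Lemma potential_round_le m (E : {set T}) (A : {ffun 'I_m -> T}) :
  0 <= r -> (0 < rank T z eps eta)%N ->
  potential (round_step d z eps eta E A)
  <= (1 / 2 + 1 / 2 *
      ((rank T z eps eta <= #|[set i | A i \in ~: I]|)%N%:R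
       + [forall i, A i \notin I :&: far d (2 * r) E]%:R)) * potential E.
Proof.
move=> r0 rank0; set E' := round_step _ _ _ _ _ _.
have sEE' : E \subset E' by exact: subset_round_step.
have h01 (n : nat) : 0 <= 2^-1 ^+ n :> R by apply: exprn_ge0; lra.
have unE' : (unfinished E')%:R <= (unfinished E)%:R :> R.
  rewrite ler_nat; case: (ltP _ #|far d (2 * r) E'|%:R) => // unE'.
  rewrite (lt_le_trans unE')// ler_nat; apply/subset_leq_card.
  exact: far_anti.
have potE0 : 0 <= potential E by rewrite mulr_ge0.
have potE : potential E' <= potential E.
  apply: ler_pM => //; apply: ler_wiXn2l; [lra|lra|].
  exact: subset_leq_card (hit_clusters_mono _ _ _ sEE').
case: leqP => outA /=; first by set b := [forall _, _]; case: b => /=; lra.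
case: (boolP [forall _, _]) => [_|] /=; first by lra.
rewrite negb_forall => /existsP[i]; rewrite negbK => Ai.
have hit : potential E' <= 1 / 2 * potential E.
  rewrite /potential mulrCA; apply: ler_pM => //.
  rewrite div1r -exprS; apply: ler_wiXn2l; [lra|lra|].
  by apply: round_hits_new => //; exists i.
by rewrite addr0 mulr0 addr0.
Qed.

Lemma sum_potential_round_le E : (0 < z)%N -> (z < #|T|)%N ->
  0 < eps -> 0 < eta -> eta < 1 -> 0 <= r ->
  \sum_(A : {ffun 'I_(nprime T z eps eta) -> T})
    potential (round_step d z eps eta E A)
  <= (1 + eta) / 2 * #|{ffun 'I_(nprime T z eps eta) -> T}|%:R * potential E.
Proof.
move=> z0 zT eps0 eta0 eta1 r0; rewrite card_ffun card_ord natrX.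
have rank0 := rank_gt0 z0 zT eps0 eta0 eta1.
have nm0 : 0 <= #|T|%:R ^+ nprime T z eps eta :> R by apply: exprn_ge0.
have potE0 : 0 <= potential E.
  by rewrite mulr_ge0//; apply: exprn_ge0; lra.
(* Far inliers are guaranteed only while [E] is unfinished; after that the potential is 0 and cannot
   rise. *)
have [unE|finE] := boolP (unfinished E); last first.
  have pot0 : potential E = 0 by rewrite /potential (negbTE finE) mul0r.
  apply: (@le_trans _ _ 0); last by rewrite pot0 mulr0.
  apply: sumr_le0 => A _.
  by apply: le_trans (potential_round_le E A r0 rank0) _; rewrite pot0 mulr0.
apply: le_trans (ler_sum _ (fun A _ => potential_round_le E A r0 rank0)) _.
rewrite -mulr_suml ler_wpM2r// big_split/= sumr_const -mulr_sumr.
rewrite big_split/= card_ffun card_ord -[X in X + _]mulr_natl natrX.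
have far0 := ltW (far_inliers_ge unE).
have := many_outliers_bound z0 zT eps0 eta0 outliers_le.
have := no_hit_bound z0 zT eps0 eta0 far0.
move: (\sum_A _) (\sum_A _) => u v; move: (_ ^+ _) nm0 => X X0.
(* The two failure bounds add up to eta X / 2, giving an average factor of at most 1 / 2 + eta / 4;
   the rest is slack. *)
have : 0 <= eta * X by rewrite mulr_ge0// ltW.
by lra.
Qed.

End Progress.

(** * Conclusion by Markov's inequality *)

Unset Implicit Arguments.

Theorem theorem10 (R : realType) (T : finType) (d : T -> T -> R)
    (k z : nat) (eps eta : R) :
  is_metric d ->
  (0 < k)%N -> (0 < z)%N -> (z < #|T|)%N ->
  0 < eps -> 0 < eta -> eta < 1 / 2 ->
  1 - 2 * eta <=
  prob R (fun w : Omega T z eps eta (t_param k eta) =>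
          phi d z eps (algo3 d w) <= 2 * r_opt d k z).
Proof.
move=> dM k0 z0 zT eps0 eta0 eta12.
have eta1 : eta < 1 by lra.
have T0 : (0 < #|T|)%N by exact: leq_ltn_trans zT.
have r0 := r_opt_ge0 d k z; set r := r_opt d k z in r0 *.
have [I [c [cardI Icov]]] := r_opt_attained d z k0 T0.
have outI : (#|~: I| <= z)%N.
  by move: cardI; rewrite leq_subLR -(cardsC I) [leqLHS]addnC leq_add2r.
set Om := Omega T z eps eta (t_param k eta).
pose Psi := potential d z eps r c.
have Om0 : 0 < #|Om|%:R :> R.
  by rewrite card_prod !card_ffun !natrM !natrX mulr_gt0 ?exprn_gt0 ?ltr0n//
    expn_gt0 T0.
rewrite /prob; set good := [set w | _].
have bad_le : #|~: good|%:R <= 2 ^+ k.-1 * \sum_(w : Om) Psi (algo3 d w).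
  rewrite -sum1_card big_mkcond natr_sum mulr_sumr.
  apply: ler_sum => w _; rewrite !inE.
  apply: le_trans (unfinished_le_potential dM outI Icov _ (ltW eps0)).
  (* A failing run is unfinished, since otherwise [phi_le] with radius 2 r would make it succeed. *)
  rewrite ler_nat; case: ifPn => //= bad; rewrite lt0b ltNge; apply/negP => fin.
  by move/negP: bad; apply; apply: phi_le => //; rewrite mulr_ge0.
have sum_le : \sum_(w : Om) Psi (algo3 d w)
    <= #|Om|%:R * ((1 + eta) / 2) ^+ nrounds (t_param k eta).
  apply: (sum_foldl_init_le
    (fun w : {ffun 'I_(ninit T z eta) -> T} => [set w i | i : 'I_(ninit T z eta)])).
  - by lra.
  - by move=> E; exact: potential_le1.
  - by move=> E; exact: (sum_potential_round_le dM outI Icov).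
rewrite ler_pdivlMr//.
have goodE : #|good|%:R = #|Om|%:R - #|~: good|%:R :> R.
  by rewrite -(cardsC good) natrD addrK.
have bad_eta : #|~: good|%:R <= #|Om|%:R * eta.
  apply: le_trans bad_le _.
  apply: le_trans (ler_wpM2l (exprn_ge0 _ (ler0n _ _)) sum_le) _.
  by rewrite mulrCA ler_pM2l//; exact: rounds_bound.
(* The failure probability is at most eta, which is relaxed to 2 eta. *)
rewrite goodE mulrBl mul1r lerD2l lerN2; apply: le_trans bad_eta _.
by rewrite mulrC ler_pM2r// mulr_natl mulr2n lerDl ltW.
Qed.
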